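(* Let $k$ be a field, let $X$ be a commutative (associative, unital) $k$-algebra, and let $p,p',q,q',\lambda,\mu\in k$. In each of the following two cases, the maps $A,B,C,D: k\times k\to \mathrm{End}_k(X\otimes X)$ (tensor products over $k$), defined for all $u,v\in k$ and $a,b\in X$ by the given formulas, are solutions of the coloured Yang--Baxter system. Case 1: $$A(u,v)(a\otimes b)=p(u-v)\,1\otimes ab+q(u-v)\,ab\otimes 1-(pu-qv)\,b\otimes a,$$ $$B(u,v)(a\otimes b)=(p'u-qv)\,1\otimes ab+(q'u-pv)\,ab\otimes 1-(p'u-pv)\,b\otimes a,$$ $$C(u,v)(a\otimes b)=(pu-q'v)\,1\otimes ab+(qu-p'v)\,ab\otimes 1-(pu-p'v)\,b\otimes a,$$ $$D(u,v)(a\otimes b)=p'(u-v)\,1\otimes ab+q'(u-v)\,ab\otimes 1-(p'u-q'v)\,b\otimes a.$$ Case 2: $$A(u,v)(a\otimes b)=p(u-v)\,1\otimes ab+q(u-v)\,ab\otimes 1-(pu-qv)\,b\otimes a,$$ $$B(u,v)(a\otimes b)=q(\mu u-\lambda v)\,1\otimes ab+p(\mu u-\lambda v)\,ab\otimes 1-(q\mu u-p\lambda v)\,b\otimes a,$$ $$C(u,v)(a\otimes b)=p(\lambda u-\mu v)\,1\otimes ab+q(\lambda u-\mu v)\,ab\otimes 1-(p\lambda u-q\mu v)\,b\otimes a,$$ $$D(u,v)(a\otimes b)=q(u-v)\,1\otimes ab+p(u-v)\,ab\otimes 1-(qu-pv)\,b\otimes a.$$ That is, in each case the following eight identities hold for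 all values $u,v,w\in k$ of the spectral parameters: $$[[A,A,A]]=0,\quad [[D,D,D]]=0,\quad [[A,C,C]]=0,\quad [[D,B,B]]=0,$$ $$[[A,B^{++},B^{++}]]=0,\quad [[D,C^{++},C^{++}]]=0,\quad [[A,C,B^{++}]]=0,\quad [[D,B,C^{++}]]=0.$$
   Context: For a $k$-vector space $V$ and functions $R,S,T: k\times k\to \mathrm{End}_k(V\otimes V)$, the coloured (spectral-parameter dependent) Yang--Baxter commutator is the function of $(u,v,w)\in k^3$ with values in $\mathrm{End}_k(V\otimes V\otimes V)$ given by $$[[R,S,T]](u,v,w):=R_{12}(u,v)S_{13}(u,w)T_{23}(v,w)-T_{23}(v,w)S_{13}(u,w)R_{12}(u,v),$$ where products denote composition and, for a linear map $Y$ on $V\otimes V$, $Y_{ij}$ denotes $Y$ acting on the $i$-th and $j$-th tensor factors of $V\otimes V\otimes V$ and as the identity on the remaining factor. The map $P: V\otimes V\to V\otimes V$ is the flip $P(a\otimes b)=b\otimes a$, and for $Y: k\times k\to\mathrm{End}_k(V\otimes V)$ one sets $Y^{++}(u,v):=P\,Y(v,u)\,P$. Here $V=X$. *)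

(* Defs.v *)
From HB Require Import structures.
From mathcomp Require Import all_boot all_algebra.
From mathcomp Require Import generic_quotient ring_quotient sesquilinear.
From mathcomp Require Import boolp.
From mathcomp.multinomials Require Import freeg.

Set Implicit Arguments.
Unset Strict Implicit.
Unset Printing Implicit Defensive.

Import GRing.Theory.
Local Open Scope ring_scope.
Local Open Scope quotient_scope.

Reserved Notation "u ⊗ v" (at level 40, left associativity).

Section Tensor.
Variables (R : comNzRingType) (U V : lmodType R).

Local Notation free := {freeg (U * V)%type / R}.
Local Notation gen u v := ([freeg [:: (1, (u, v))]] : free).

(* The submodule generated by the bilinearity relations. *)
Inductive tensor_rel : free -> Prop :=
| tensor_rel0 : tensor_rel 0
| tensor_relP c x y : tensor_rel x -> tensor_rel y -> tensor_rel (c *: x + y)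
| tensor_relDl u1 u2 v : tensor_rel (gen (u1 + u2) v - (gen u1 v + gen u2 v))
| tensor_relDr u v1 v2 : tensor_rel (gen u (v1 + v2) - (gen u v1 + gen u v2))
| tensor_relZl c u v : tensor_rel (gen (c *: u) v - c *: gen u v)
| tensor_relZr c u v : tensor_rel (gen u (c *: v) - c *: gen u v).

Definition tensor_relb : {pred free} := fun x => `[< tensor_rel x >].

Lemma tensor_relbP x : reflect (tensor_rel x) (x \in tensor_relb).
Proof. exact: asboolP. Qed.

Lemma tensor_rel_submod : submod_closed tensor_relb.
Proof.
split; first exact/tensor_relbP/tensor_rel0.
by move=> c x y /tensor_relbP hx /tensor_relbP hy; apply/tensor_relbP/tensor_relP.
Qed.

HB.instance Definition _ :=
  GRing.isSubmodClosed.Build R free tensor_relb tensor_rel_submod.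

Definition tensor : Type := Quotient.quot tensor_relb.

HB.instance Definition _ := GRing.Zmodule.on tensor.
HB.instance Definition _ := Quotient.on tensor.

Lemma tensorW (P : tensor -> Prop) :
  (forall x : free, P (\pi_tensor x)) -> forall t, P t.
Proof. by move=> h t; rewrite -[t]reprK; apply: h. Qed.

Lemma tensor_eqP (x y : free) :
  reflect (\pi_tensor x = \pi_tensor y) (x - y \in tensor_relb).
Proof. by rewrite Quotient.idealrBE; exact: eqP. Qed.

Lemma pi_tensorD (x y : free) :
  \pi_tensor (x + y) = \pi_tensor x + \pi_tensor y.
Proof. exact: (Quotient.pi_add _ x y). Qed.

Definition tensor_scale (c : R) (t : tensor) : tensor := \pi_tensor (c *: repr t).

Lemma tensor_scale_pi c (x : free) :
  tensor_scale c (\pi_tensor x) = \pi_tensor (c *: x).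
Proof.
apply/tensor_eqP; rewrite -scalerBr; apply: rpredZ.
by apply/tensor_eqP; rewrite reprK.
Qed.

Fact tensor_scaleA a b t :
  tensor_scale a (tensor_scale b t) = tensor_scale (a * b) t.
Proof. by elim/tensorW: t => x; rewrite !tensor_scale_pi scalerA. Qed.

Fact tensor_scale1 : left_id 1 tensor_scale.
Proof. by elim/tensorW => x; rewrite !tensor_scale_pi scale1r. Qed.

Fact tensor_scaleDr : right_distributive tensor_scale +%R.
Proof.
move=> c; elim/tensorW => x; elim/tensorW => y.
by rewrite -pi_tensorD !tensor_scale_pi scalerDr pi_tensorD.
Qed.

Fact tensor_scaleDl t : {morph tensor_scale^~ t : a b / a + b}.
Proof.
move=> a b /=; elim/tensorW: t => x.
by rewrite !tensor_scale_pi scalerDl pi_tensorD.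
Qed.

HB.instance Definition _ := GRing.Zmodule_isLmodule.Build R tensor
  tensor_scaleA tensor_scale1 tensor_scaleDr tensor_scaleDl.

Definition tens (u : U) (v : V) : tensor := \pi_tensor (gen u v).

Lemma pi_tensorZ c (x : free) : \pi_tensor (c *: x) = c *: \pi_tensor x.
Proof. by rewrite -tensor_scale_pi. Qed.

Fact tensor_rel_split (x y a b : free) :
  x - (a + b) = x - (y + b) + (y - a).
Proof. by rewrite [y + b]addrC [a + b]addrC !opprD !addrA addrNK. Qed.

Lemma tens_is_bilinear : bilinear_for *:%R *:%R tens.
Proof.
split=> [v c u1 u2|u c v1 v2] /=; rewrite /tens -pi_tensorZ -pi_tensorD;
  apply/tensor_eqP/tensor_relbP.
- rewrite (tensor_rel_split _ (gen (c *: u1) v)) -[X in X + _]scale1r.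
  by apply: tensor_relP; [exact: tensor_relDl | exact: tensor_relZl].
- rewrite (tensor_rel_split _ (gen u (c *: v1))) -[X in X + _]scale1r.
  by apply: tensor_relP; [exact: tensor_relDr | exact: tensor_relZr].
Qed.

HB.instance Definition _ :=
  bilinear_isBilinear.Build R U V tensor *:%R *:%R tens tens_is_bilinear.

Lemma tensPl c u1 u2 v : tens (c *: u1 + u2) v = c *: tens u1 v + tens u2 v.
Proof. exact: (linearPl tens). Qed.

Lemma tensPr c u v1 v2 : tens u (c *: v1 + v2) = c *: tens u v1 + tens u v2.
Proof. exact: (linearPr tens). Qed.

Lemma tensor_ind (P : tensor -> Prop) :
  P 0 -> (forall c u v t, P t -> P (c *: tens u v + t)) -> forall t, P t.
Proof.
move=> P0 PD; elim/tensorW => x; rewrite -(freeg_sumE x).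
elim: (dom x) => [|[u v] s IHs].
  by rewrite big_nil; rewrite -(scale0r 0) pi_tensorZ scale0r.
rewrite big_cons pi_tensorD.
have -> : [freeg [:: (coeff (u, v) x, (u, v))]] = coeff (u, v) x *: gen u v.
  by apply/eqP/freeg_eqP => z; rewrite coeffZ !coeffU mul1r.
by rewrite pi_tensorZ; apply: PD.
Qed.

End Tensor.

Notation "u ⊗ v" := (tens u v) : ring_scope.

(* Universal property of ⊗: [tlift] with [tliftE], uniqueness by [tensor_ext]. *)
Section Lift.
Variables (R : comNzRingType) (U V W : lmodType R).

Section Def.
Variable f : {bilinear U -> V -> W}.

Local Notation free := {freeg (U * V)%type / R}.
Local Notation flift := (fglift (fun uv : U * V => f uv.1 uv.2)).

Definition tlift (t : tensor U V) : W := flift (repr t).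

Fact fliftD (x y : free) : flift (x + y) = flift x + flift y.
Proof.
have fB := lift_is_additive (fun uv : U * V => f uv.1 uv.2).
have f0 : flift 0 = 0 by rewrite -[0 in LHS](subrr 0) fB subrr.
by rewrite -[y in LHS]opprK fB -[- y]sub0r fB f0 sub0r opprK.
Qed.

Fact fliftZ c (x : free) : flift (c *: x) = c *: flift x.
Proof.
have fB := lift_is_additive (fun uv : U * V => f uv.1 uv.2).
have f0 : flift 0 = 0 by rewrite -[0 in LHS](subrr 0) fB subrr.
rewrite -(freeg_sumE x); elim: (dom x) => [|z s IHs].
  by rewrite big_nil scaler0 f0 scaler0.
rewrite big_cons scalerDr !fliftD scalerDr IHs; congr (_ + _).
have -> : c *: [freeg [:: (coeff z x, z)]] =
    [freeg [:: (c * coeff z x, z)]] :> free.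
  by apply/eqP/freeg_eqP => w; rewrite coeffZ !coeffU mulrA.
by rewrite !liftU scalerA.
Qed.

Fact flift_gen u v : flift [freeg [:: (1, (u, v))]] = f u v.
Proof. by rewrite liftU scale1r. Qed.

Fact flift_rel x : tensor_rel x -> flift x = 0.
Proof.
have fN (y : free) : flift (- y) = - flift y by rewrite -!scaleN1r fliftZ.
elim=> {x} [|c x y _ hx _ hy|u1 u2 v|u v1 v2|c u v|c u v].
- by rewrite -(scale0r 0) fliftZ scale0r.
- by rewrite fliftD fliftZ hx hy scaler0 addr0.
- by rewrite fliftD fN fliftD !flift_gen linearDl subrr.
- by rewrite fliftD fN fliftD !flift_gen linearDr subrr.
- by rewrite fliftD fN fliftZ !flift_gen linearZl_LR subrr.
- by rewrite fliftD fN fliftZ !flift_gen linearZr_LR subrr.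
Qed.

Fact tlift_pi (x : free) : tlift (\pi_(tensor U V) x) = flift x.
Proof.
apply/eqP; rewrite -subr_eq0 -scaleN1r -fliftZ -fliftD scaleN1r; apply/eqP.
by apply/flift_rel/tensor_relbP/tensor_eqP; rewrite reprK.
Qed.

Fact tlift_is_linear : linear tlift.
Proof.
move=> c; elim/tensorW => x; elim/tensorW => y.
by rewrite -pi_tensorZ -pi_tensorD !tlift_pi fliftD fliftZ.
Qed.

HB.instance Definition _ :=
  GRing.isLinear.Build R (tensor U V) W *:%R tlift tlift_is_linear.

Lemma tliftE u v : tlift (u ⊗ v) = f u v.
Proof. by rewrite tlift_pi flift_gen. Qed.

End Def.

Lemma tensor_ext (g h : {linear tensor U V -> W}) :
  (forall u v, g (u ⊗ v) = h (u ⊗ v)) -> g =1 h.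
Proof.
move=> gh; elim/tensor_ind => [|c u v t IHt]; first by rewrite !linear0.
by rewrite !linearP gh IHt.
Qed.

End Lift.

Section Maps.
Variable R : comNzRingType.

Section Map.
Variables (U V U' V' : lmodType R).
Variables (f : {linear U -> U'}) (g : {linear V -> V'}).

Definition tmap_fun u v := f u ⊗ g v.

Fact tmap_is_bilinear : bilinear_for *:%R *:%R tmap_fun.
Proof.
by split=> [v c u1 u2|u c v1 v2];
  rewrite /= /tmap_fun linearP ?tensPl ?tensPr.
Qed.

HB.instance Definition _ :=
  bilinear_isBilinear.Build R U V (tensor U' V') *:%R *:%R tmap_fun tmap_is_bilinear.

Definition tmap : {linear tensor U V -> tensor U' V'} := tlift tmap_fun.

Lemma tmapE u v : tmap (u ⊗ v) = f u ⊗ g v.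
Proof. exact: tliftE. Qed.

End Map.

Section Flip.
Variables U V : lmodType R.

Definition tflip_fun (u : U) (v : V) := v ⊗ u.

Fact tflip_is_bilinear : bilinear_for *:%R *:%R tflip_fun.
Proof.
by split=> [v c u1 u2|u c v1 v2]; rewrite /= /tflip_fun ?tensPl ?tensPr.
Qed.

HB.instance Definition _ :=
  bilinear_isBilinear.Build R U V (tensor V U) *:%R *:%R
    tflip_fun tflip_is_bilinear.

Definition tflip : {linear tensor U V -> tensor V U} := tlift tflip_fun.

Lemma tflipE u v : tflip (u ⊗ v) = v ⊗ u.
Proof. exact: tliftE. Qed.

End Flip.

Section Assoc.
Variables U V W : lmodType R.

Section Inner.
Variable w : W.
Definition tassoc_fun1 (u : U) (v : V) := u ⊗ (v ⊗ w).

Fact tassoc_fun1_is_bilinear : bilinear_for *:%R *:%R tassoc_fun1.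
Proof.
by split=> [v c u1 u2|u c v1 v2];
  rewrite /= /tassoc_fun1 ?tensPl ?tensPr.
Qed.

HB.instance Definition _ :=
  bilinear_isBilinear.Build R U V (tensor U (tensor V W)) *:%R *:%R
    tassoc_fun1 tassoc_fun1_is_bilinear.
End Inner.

Fact tassoc_fun1E w u v : tlift (tassoc_fun1 w) (u ⊗ v) = u ⊗ (v ⊗ w).
Proof. exact: tliftE. Qed.

Definition tassoc_fun (t : tensor U V) (w : W) := tlift (tassoc_fun1 w) t.

Fact tassoc_is_bilinear : bilinear_for *:%R *:%R tassoc_fun.
Proof.
split=> [w c t1 t2|t c w1 w2]; rewrite /= /tassoc_fun ?linearP //.
elim/tensor_ind: t => [|d u v t IHt]; first by rewrite !linear0 addr0.
rewrite !(linearP (tlift _)) /= IHt !tassoc_fun1E !tensPr !scalerDr !scalerA.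
by rewrite [d * c]mulrC addrACA.
Qed.

HB.instance Definition _ :=
  bilinear_isBilinear.Build R (tensor U V) W (tensor U (tensor V W)) *:%R *:%R
    tassoc_fun tassoc_is_bilinear.

Definition tassoc :
    {linear tensor (tensor U V) W -> tensor U (tensor V W)} :=
  tlift tassoc_fun.

Lemma tassocE u v w : tassoc (u ⊗ v ⊗ w) = u ⊗ (v ⊗ w).
Proof. by rewrite [LHS]tliftE; exact: tassoc_fun1E. Qed.

Section InnerV.
Variable u : U.
Definition tassocV_fun1 (v : V) (w : W) := u ⊗ v ⊗ w.

Fact tassocV_fun1_is_bilinear : bilinear_for *:%R *:%R tassocV_fun1.
Proof.
by split=> [w c v1 v2|v c w1 w2];
  rewrite /= /tassocV_fun1 ?tensPr ?tensPl ?tensPr.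
Qed.

HB.instance Definition _ :=
  bilinear_isBilinear.Build R V W (tensor (tensor U V) W) *:%R *:%R
    tassocV_fun1 tassocV_fun1_is_bilinear.
End InnerV.

Fact tassocV_fun1E u v w : tlift (tassocV_fun1 u) (v ⊗ w) = u ⊗ v ⊗ w.
Proof. exact: tliftE. Qed.

Definition tassocV_fun (u : U) (t : tensor V W) := tlift (tassocV_fun1 u) t.

Fact tassocV_is_bilinear : bilinear_for *:%R *:%R tassocV_fun.
Proof.
split=> [t c u1 u2|u c t1 t2]; rewrite /= /tassocV_fun ?linearP //.
elim/tensor_ind: t => [|d v w t IHt]; first by rewrite !linear0 addr0.
rewrite !(linearP (tlift _)) /= IHt !tassocV_fun1E !tensPl !scalerDr !scalerA.
by rewrite [d * c]mulrC addrACA.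
Qed.

HB.instance Definition _ :=
  bilinear_isBilinear.Build R U (tensor V W) (tensor (tensor U V) W) *:%R *:%R
    tassocV_fun tassocV_is_bilinear.

Definition tassocV :
    {linear tensor U (tensor V W) -> tensor (tensor U V) W} :=
  tlift tassocV_fun.

Lemma tassocVE u v w : tassocV (u ⊗ (v ⊗ w)) = u ⊗ v ⊗ w.
Proof. by rewrite [LHS]tliftE; exact: tassocV_fun1E. Qed.

End Assoc.

End Maps.

Section YangBaxter.
Variables (k : fieldType) (V : lmodType k).

(* V ⊗ V ⊗ V is (V ⊗ V) ⊗ V. *)
Local Notation T2 := (tensor V V).
Local Notation T3 := (tensor (tensor V V) V).
Local Notation End2 := {linear T2 -> T2}.
Local Notation End3 := {linear T3 -> T3}.
Implicit Types (Y : End2) (R S T : k -> k -> End2).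

Definition leg12 Y : End3 := tmap Y idfun.

Definition leg23 Y : End3 := tassocV V V V \o tmap idfun Y \o tassoc V V V.

(* Y_13 = P_23 Y_12 P_23 with P the flip. *)
Definition leg13 Y : End3 := leg23 (tflip V V) \o leg12 Y \o leg23 (tflip V V).

Lemma leg12E Y a b c : leg12 Y (a ⊗ b ⊗ c) = Y (a ⊗ b) ⊗ c.
Proof. exact: tmapE. Qed.

Lemma leg23E Y a b c : leg23 Y (a ⊗ b ⊗ c) = tassocV V V V (a ⊗ Y (b ⊗ c)).
Proof. by rewrite /= tassocE tmapE. Qed.

Lemma leg13E Y a b c :
  leg13 Y (a ⊗ b ⊗ c) = leg23 (tflip V V) (Y (a ⊗ c) ⊗ b).
Proof.
by rewrite [LHS]/= tassocE tmapE tflipE tassocVE tmapE.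
Qed.

Definition coloured_comm R S T (u v w : k) : End3 :=
  (leg12 (R u v) \o leg13 (S u w) \o leg23 (T v w)) \-
  (leg23 (T v w) \o leg13 (S u w) \o leg12 (R u v)).

Definition coloured_comm_vanishes R S T : Prop :=
  forall u v w : k, coloured_comm R S T u v w =1 \0.

Definition plusplus R : k -> k -> End2 :=
  fun u v => tflip V V \o R v u \o tflip V V.

Definition coloured_YB_system (A B C D : k -> k -> End2) : Prop :=
  [/\ [/\ coloured_comm_vanishes A A A & coloured_comm_vanishes D D D],
      [/\ coloured_comm_vanishes A C C & coloured_comm_vanishes D B B],
      [/\ coloured_comm_vanishes A (plusplus B) (plusplus B)
        & coloured_comm_vanishes D (plusplus C) (plusplus C)]
    & [/\ coloured_comm_vanishes A C (plusplus B)
        & coloured_comm_vanishes D B (plusplus C)]].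

End YangBaxter.

Section MulFlip.
Variables (k : fieldType) (X : lmodType k) (one : X) (mul : {bilinear X -> X -> X}).

Definition mulflip_fun (x y z : k) (a b : X) : tensor X X :=
  x *: (one ⊗ mul a b) + y *: (mul a b ⊗ one) - z *: (b ⊗ a).

Fact mulflip_comb (x y z c : k) (p1 p2 q1 q2 r1 r2 : tensor X X) :
  x *: (c *: p1 + p2) + y *: (c *: q1 + q2) - z *: (c *: r1 + r2) =
  c *: (x *: p1 + y *: q1 - z *: r1) + (x *: p2 + y *: q2 - z *: r2).
Proof.
rewrite scalerBr !scalerDr !scalerA ![_ * c]mulrC.
by rewrite opprD [X in X + _ = _]addrACA [LHS]addrACA.
Qed.

Fact mulflip_is_bilinear x y z : bilinear_for *:%R *:%R (mulflip_fun x y z).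
Proof.
split=> [b c a1 a2|a c b1 b2]; rewrite /= /mulflip_fun.
  by rewrite (linearPl mul) tensPl !tensPr -mulflip_comb.
by rewrite (linearPr mul) !tensPl tensPr -mulflip_comb.
Qed.

HB.instance Definition _ x y z :=
  bilinear_isBilinear.Build k X X (tensor X X) *:%R *:%R
    (mulflip_fun x y z) (mulflip_is_bilinear x y z).

(* Every formula of this shape on pure tensors defines an endomorphism of
   X ⊗ X; by [tensor_ext] it is unique. *)
Lemma mulflip_exists (x y z : k) :
  exists Y : {linear tensor X X -> tensor X X}, forall a b : X,
    Y (a ⊗ b) = x *: (one ⊗ mul a b) + y *: (mul a b ⊗ one) - z *: (b ⊗ a).
Proof. by exists (tlift (mulflip_fun x y z)) => a b; exact: tliftE. Qed.

End MulFlip.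

(* Main.v *)
Require Import Defs.
From mathcomp Require Import all_boot all_algebra sesquilinear ring.

Set Implicit Arguments.
Unset Strict Implicit.
Unset Printing Implicit Defensive.

Import GRing.Theory.
Local Open Scope ring_scope.

(** On a pure tensor both sides of the Yang-Baxter equation for three operators
    a ⊗ b |-> x (1 ⊗ ab) + y (ab ⊗ 1) - z (b ⊗ a) are combinations of the same
    ten pure tensors. Equality of the coefficients amounts to five cubic
    identities, which in every instance of the coloured system are polynomial
    identities in the parameters. The operation [plusplus] preserves the shape
    of the operators: it exchanges x with y and u with v. *)

Section LinearCombination.
Variables (k : pzRingType) (M : lmodType k) (n : nat) (e : nat -> M).
Implicit Types f g : nat -> k.

(** Coefficients are functions on [nat], not on ordinals, so that after a case split on the index
    the tests [j == i] compute to numerals. *)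
Definition lincomb f : M := \sum_(i < n) f i *: e i.

Lemma lincombD f g : lincomb f + lincomb g = lincomb (fun i => f i + g i).
Proof. by rewrite -big_split; apply: eq_bigr => i _; rewrite scalerDl. Qed.

Lemma lincombN f : - lincomb f = lincomb (fun i => - f i).
Proof. by rewrite -sumrN; apply: eq_bigr => i _; rewrite scaleNr. Qed.

Lemma lincombZ c f : c *: lincomb f = lincomb (fun i => c * f i).
Proof. by rewrite scaler_sumr; apply: eq_bigr => i _; rewrite scalerA. Qed.

Lemma lincomb_delta i : (i < n)%N -> e i = lincomb (fun j => (j == i)%:R).
Proof.
move=> lt_in; rewrite /lincomb (bigD1 (Ordinal lt_in)) //= eqxx scale1r.
rewrite big1 ?addr0 // => j; rewrite -val_eqE => /negPf/= ->.
by rewrite scale0r.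
Qed.

(** The family [e] may be linearly dependent, as happens for special a, b, c; comparing coefficients
    is still sufficient. *)
Lemma eq_lincomb f g :
  (forall i, (i < n)%N -> f i = g i) -> lincomb f = lincomb g.
Proof. by move=> fg; apply: eq_bigr => i _; rewrite fg. Qed.

End LinearCombination.

Lemma tensor3_ext (R : comNzRingType) (U V W Z : lmodType R)
    (g h : {linear tensor (tensor U V) W -> Z}) :
  (forall a b c, g (a ⊗ b ⊗ c) = h (a ⊗ b ⊗ c)) -> g =1 h.
Proof.
move=> gh; apply: tensor_ext => t c.
elim/tensor_ind: t => [|d a b t IHt].
  (* Writing the left factor 0 as [0 *: 0] pulls a zero scalar out of the tensor and then out of [g]
     and [h]. *)
  by rewrite -(scale0r 0) (linearZl_LR (@tens _ _ _)) !linearZ /= !scale0r.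
by rewrite tensPl !linearP gh IHt.
Qed.

Section MulflipYangBaxter.
Variables (k : fieldType) (X : lmodType k) (mul : {bilinear X -> X -> X}).
Variable one : X.
Hypotheses (mulA : associative mul) (mulC : commutative mul).
Hypothesis mul1 : left_id one mul.

Local Notation T2 := (tensor X X).
Local Notation T3 := (tensor T2 X).
Implicit Types (x y z : k) (Y : {linear T2 -> T2}).

Definition mulflip_spec x y z Y : Prop :=
  forall a b, Y (a ⊗ b) = mulflip_fun one mul x y z a b.

Lemma mulflip_leg12 x y z Y a b c : mulflip_spec x y z Y ->
  leg12 Y (a ⊗ b ⊗ c) = x *: (one ⊗ mul a b ⊗ c) + y *: (mul a b ⊗ one ⊗ c)
                        - z *: (b ⊗ a ⊗ c).
Proof.
by move=> YE; rewrite leg12E YE linearBl linearDl !linearZl_LR.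
Qed.

Lemma mulflip_leg23 x y z Y a b c : mulflip_spec x y z Y ->
  leg23 Y (a ⊗ b ⊗ c) = x *: (a ⊗ one ⊗ mul b c) + y *: (a ⊗ mul b c ⊗ one)
                        - z *: (a ⊗ c ⊗ b).
Proof.
move=> YE; rewrite leg23E YE /mulflip_fun.
by rewrite linearBr linearDr !linearZr_LR linearB linearD !linearZ /= !tassocVE.
Qed.

(** After Y acts on a ⊗ c with b parked in the third slot, flipping the last two factors moves b
    back to the middle. *)
Lemma mulflip_leg13 x y z Y a b c : mulflip_spec x y z Y ->
  leg13 Y (a ⊗ b ⊗ c) = x *: (one ⊗ b ⊗ mul a c) + y *: (mul a c ⊗ b ⊗ one)
                        - z *: (c ⊗ b ⊗ a).
Proof.
move=> YE; rewrite leg13E YE /mulflip_fun linearBl linearDl !linearZl_LR.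
by rewrite linearB linearD !linearZ !leg23E !tflipE !tassocVE.
Qed.

(* The differences of the coefficients of 1 ⊗ abc ⊗ 1, 1 ⊗ bc ⊗ a, bc ⊗ 1 ⊗ a,
   c ⊗ 1 ⊗ ab and c ⊗ ab ⊗ 1; those of the other five tensors cancel. *)
Definition yb_conditions (x1 y1 z1 x2 y2 z2 x3 y3 z3 : k) : Prop :=
  [/\ x1 * y2 * (x3 + y3 - z3) - (x1 + y1 - z1) * x2 * y3
        + y1 * x2 * z3 - z1 * y2 * x3 = 0,
      x1 * x2 * y3 - x1 * z2 * (x3 + y3 - z3) - z1 * x2 * z3 + z1 * z2 * x3 = 0,
      y1 * x2 * y3 - y1 * z2 * (x3 + y3 - z3)
        - z1 * x2 * y3 + z1 * y2 * x3 - z1 * y2 * z3 + z1 * z2 * y3 = 0,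
      x1 * y2 * z3 - x1 * y2 * x3 + x1 * z2 * x3 - x1 * z2 * z3
        - y1 * x2 * z3 + y1 * z2 * x3 + z1 * x2 * z3 - z1 * z2 * x3 = 0
    & (x1 + y1 - z1) * z2 * y3 - x1 * y2 * y3 - y1 * z2 * z3 + z1 * y2 * z3 = 0].

Lemma mulflip_yang_baxter (R S T : {linear T2 -> T2})
    x1 y1 z1 x2 y2 z2 x3 y3 z3 :
    mulflip_spec x1 y1 z1 R -> mulflip_spec x2 y2 z2 S ->
    mulflip_spec x3 y3 z3 T -> yb_conditions x1 y1 z1 x2 y2 z2 x3 y3 z3 ->
  leg12 R \o leg13 S \o leg23 T =1 leg23 T \o leg13 S \o leg12 R.
Proof.
move=> RE SE TE [c1 c2 c3 c4 c5].
have mulr1 a : mul a one = a by rewrite mulC mul1.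
apply: tensor3_ext => a b c.
have lin (f : {linear T3 -> T3}) x y z t1 t2 t3 :
    f (x *: t1 + y *: t2 - z *: t3) = x *: f t1 + y *: f t2 - z *: f t3.
  by rewrite linearB linearD !linearZ.
have E12 a' b' c' := mulflip_leg12 a' b' c' RE.
have E13 a' b' c' := mulflip_leg13 a' b' c' SE.
have E23 a' b' c' := mulflip_leg23 a' b' c' TE.
(* Forgetting that the legs are canonically linear keeps rewriting fast. *)
move: (leg12 R) (leg13 S) (leg23 T) E12 E13 E23 => F12 F13 F23 /=.
move: (F12 : _ -> _) (F13 : _ -> _) (F23 : _ -> _) (lin F12) (lin F13) (lin F23).
move=> f12 f13 f23 L12 L13 L23 E12 E13 E23.
(* Three operators with three terms each give 27 terms per side; the unit laws and associativity
   then leave only ten distinct pure tensors. *)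
rewrite E12 E23 L13 L12 L13 L23 !E13 !L12 !L23 !E12 !E23.
rewrite !(mul1, mulr1) -!mulA.
move: (one ⊗ mul a (mul b c) ⊗ one) (one ⊗ mul b c ⊗ a) (mul b c ⊗ one ⊗ a)
  (c ⊗ one ⊗ mul a b) (c ⊗ mul a b ⊗ one) (one ⊗ one ⊗ mul a (mul b c))
  (mul a (mul b c) ⊗ one ⊗ one) (one ⊗ c ⊗ mul a b) (mul b c ⊗ a ⊗ one)
  (c ⊗ b ⊗ a) => e0 e1 e2 e3 e4 e5 e6 e7 e8 e9.
(* The first five vectors follow the order of [yb_conditions]. The default 0 is never reached, since
   all indices are below 10. *)
pose e := nth 0 [:: e0; e1; e2; e3; e4; e5; e6; e7; e8; e9].
have E i : (i < 10)%N -> e i = lincomb 10 e (fun j => (j == i)%:R).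
  exact: lincomb_delta.
rewrite (E 0 isT : e0 = _) (E 1 isT : e1 = _) (E 2 isT : e2 = _).
rewrite (E 3 isT : e3 = _) (E 4 isT : e4 = _) (E 5 isT : e5 = _).
rewrite (E 6 isT : e6 = _) (E 7 isT : e7 = _) (E 8 isT : e8 = _).
rewrite (E 9 isT : e9 = _) {E}.
rewrite !(lincombD, lincombN, lincombZ).
apply: eq_lincomb => i lt_i; apply: subr0_eq.
case: i lt_i => [|[|[|[|[|[|[|[|[|[|//]]]]]]]]]] _ /=.
(* Replacing 0 by the matching cubic leaves a polynomial identity free of side conditions; for the
   last five indices the two coefficients agree outright. *)
- by rewrite -[RHS]c1; ring.
- by rewrite -[RHS]c2; ring.
- by rewrite -[RHS]c3; ring.
- by rewrite -[RHS]c4; ring.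
- by rewrite -[RHS]c5; ring.
all: by ring.
Qed.

Lemma mulflip_comm_vanishes (R S T : k -> k -> {linear T2 -> T2})
    (x1 y1 z1 x2 y2 z2 x3 y3 z3 : k -> k -> k) :
    (forall u v, mulflip_spec (x1 u v) (y1 u v) (z1 u v) (R u v)) ->
    (forall u w, mulflip_spec (x2 u w) (y2 u w) (z2 u w) (S u w)) ->
    (forall v w, mulflip_spec (x3 v w) (y3 v w) (z3 v w) (T v w)) ->
    (forall u v w, yb_conditions
      (x1 u v) (y1 u v) (z1 u v) (x2 u w) (y2 u w) (z2 u w)
      (x3 v w) (y3 v w) (z3 v w)) ->
  coloured_comm_vanishes R S T.
Proof.
move=> RE SE TE cond u v w t; apply/eqP; rewrite subr_eq0; apply/eqP.
exact: mulflip_yang_baxter (RE u v) (SE u w) (TE v w) (cond u v w) t.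
Qed.

(** Conjugation by the flip swaps 1 ⊗ ab with ab ⊗ 1 and fixes the flip term; commutativity turns
    the resulting ba into ab. *)
Lemma mulflip_plusplus (Y : k -> k -> {linear T2 -> T2}) (x y z : k -> k -> k) :
    (forall u v, mulflip_spec (x u v) (y u v) (z u v) (Y u v)) ->
  forall u v, mulflip_spec (y v u) (x v u) (z v u) (plusplus Y u v).
Proof.
move=> YE u v a b; rewrite [LHS]/= tflipE YE /mulflip_fun.
by rewrite linearB linearD !linearZ /= !tflipE (mulC b) [X in X + _ = _]addrC.
Qed.

End MulflipYangBaxter.

(* A commutative k-algebra is a k-module X with a bilinear, associative and
   commutative product and a unit; [comAlgType k] would exclude X = 0. *)
Theorem theorem3p1 (k : fieldType) (X : lmodType k)
    (mul : {bilinear X -> X -> X}) (one : X)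
    (mulA : associative mul) (mulC : commutative mul) (mul1 : left_id one mul)
    (p p' q q' lambda mu : k) :
  (forall A B C D : k -> k -> {linear tensor X X -> tensor X X},
     (forall (u v : k) (a b : X),
        A u v (a ⊗ b) = (p * (u - v)) *: (one ⊗ mul a b)
                        + (q * (u - v)) *: (mul a b ⊗ one)
                        - (p * u - q * v) *: (b ⊗ a)) ->
     (forall (u v : k) (a b : X),
        B u v (a ⊗ b) = (p' * u - q * v) *: (one ⊗ mul a b)
                        + (q' * u - p * v) *: (mul a b ⊗ one)
                        - (p' * u - p * v) *: (b ⊗ a)) ->
     (forall (u v : k) (a b : X),
        C u v (a ⊗ b) = (p * u - q' * v) *: (one ⊗ mul a b)
                        + (q * u - p' * v) *: (mul a b ⊗ one)
                        - (p * u - p' * v) *: (b ⊗ a)) ->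
     (forall (u v : k) (a b : X),
        D u v (a ⊗ b) = (p' * (u - v)) *: (one ⊗ mul a b)
                        + (q' * (u - v)) *: (mul a b ⊗ one)
                        - (p' * u - q' * v) *: (b ⊗ a)) ->
     coloured_YB_system A B C D) /\
  (forall A B C D : k -> k -> {linear tensor X X -> tensor X X},
     (forall (u v : k) (a b : X),
        A u v (a ⊗ b) = (p * (u - v)) *: (one ⊗ mul a b)
                        + (q * (u - v)) *: (mul a b ⊗ one)
                        - (p * u - q * v) *: (b ⊗ a)) ->
     (forall (u v : k) (a b : X),
        B u v (a ⊗ b) = (q * (mu * u - lambda * v)) *: (one ⊗ mul a b)
                        + (p * (mu * u - lambda * v)) *: (mul a b ⊗ one)
                        - (q * mu * u - p * lambda * v) *: (b ⊗ a)) ->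
     (forall (u v : k) (a b : X),
        C u v (a ⊗ b) = (p * (lambda * u - mu * v)) *: (one ⊗ mul a b)
                        + (q * (lambda * u - mu * v)) *: (mul a b ⊗ one)
                        - (p * lambda * u - q * mu * v) *: (b ⊗ a)) ->
     (forall (u v : k) (a b : X),
        D u v (a ⊗ b) = (q * (u - v)) *: (one ⊗ mul a b)
                        + (p * (u - v)) *: (mul a b ⊗ one)
                        - (q * u - p * v) *: (b ⊗ a)) ->
     coloured_YB_system A B C D).
Proof.
split=> A B C D AE BE CE DE.
(* The three coefficients are read off from the given formula by unification. *)
all: have A_spec u v : mulflip_spec mul one _ _ _ (A u v) := AE u v.
all: have B_spec u v : mulflip_spec mul one _ _ _ (B u v) := BE u v.
all: have C_spec u v : mulflip_spec mul one _ _ _ (C u v) := CE u v.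
all: have D_spec u v : mulflip_spec mul one _ _ _ (D u v) := DE u v.
all: have Bpp_spec := mulflip_plusplus mulC B_spec.
all: have Cpp_spec := mulflip_plusplus mulC C_spec.
all: (split; split);
  [ apply: (mulflip_comm_vanishes mulA mulC mul1 A_spec A_spec A_spec)
  | apply: (mulflip_comm_vanishes mulA mulC mul1 D_spec D_spec D_spec)
  | apply: (mulflip_comm_vanishes mulA mulC mul1 A_spec C_spec C_spec)
  | apply: (mulflip_comm_vanishes mulA mulC mul1 D_spec B_spec B_spec)
  | apply: (mulflip_comm_vanishes mulA mulC mul1 A_spec Bpp_spec Bpp_spec)
  | apply: (mulflip_comm_vanishes mulA mulC mul1 D_spec Cpp_spec Cpp_spec)
  | apply: (mulflip_comm_vanishes mulA mulC mul1 A_spec C_spec Bpp_spec)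
  | apply: (mulflip_comm_vanishes mulA mulC mul1 D_spec B_spec Cpp_spec) ].
(* Eight equations in each of two cases, with five cubics apiece: all are polynomial identities in
   the parameters and u, v, w. *)
all: by move=> u v w; split; ring.
Qed.
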